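(* Let $p$ be a prime, let $q$ be a power of $p$, and let $f(x)\in\mathbb{Z}[x]$ be a polynomial whose reduction modulo $p$ (obtained by reducing each coefficient modulo $p$) equals $x^q+x$. Then for every integer $n\geq 2$ the polynomial $\Phi_{p^n}(x)$ attached to $f$ is an Eisenstein polynomial over $\mathbb{Q}$.
   Context: For a polynomial $f$ and an integer $j\geq 1$, $f^j$ denotes the $j$-fold composition $f\circ\cdots\circ f$. For $k\geq 1$ define $\Phi_k(x):=\prod_{d\mid k}\bigl(f^d(x)-x\bigr)^{\mu(k/d)}$, where $\mu$ is the Möbius function; this rational function is in fact a polynomial (with integer coefficients when $f\in\mathbb{Z}[x]$).
   Formalization: The formal theorem additionally assumes deg f = q (so p does not divide the leading coefficient of f) and q > 1; without the degree condition the claim fails, e.g. p = q = 2, f = 2x^3 + x^2 + x, n = 2, where Φ_4 has constant term 2 and leading coefficient 2^36. *)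

(* Defs.v *)
From HB Require Import structures.
From mathcomp Require Import all_boot all_order all_algebra.

Set Implicit Arguments.
Unset Strict Implicit.
Unset Printing Implicit Defensive.

Import Order.TTheory GRing.Theory Num.Theory.
Local Open Scope ring_scope.

(* Only meaningful for n > 0. *)
Definition mobius (n : nat) : int :=
  if all (fun l => logn l n == 1%N) (primes n) then (-1) ^+ size (primes n)
  else 0.

Definition compiter (R : nzRingType) (f : {poly R}) (j : nat) : {poly R} :=
  iter j (fun g => f \Po g) 'X.

(* The exponents are integers in {-1, 0, 1}, so the product is formed in the
   fraction field of Z[x], that is, Q(x). *)
Definition dynatomic (f : {poly int}) (k : nat) : {fraction {poly int}} :=
  \prod_(d <- divisors k)
     (tofrac (compiter f d - 'X)) ^ (mobius (k %/ d)).

Definition eisenstein_at (l : nat) (P : {poly int}) : Prop :=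
  [/\ (1 < size P)%N,
      ~~ (l%:Z %| lead_coef P)%Z,
      forall i : nat, (i < (size P).-1)%N -> (l%:Z %| P`_i)%Z
    & ~~ (l%:Z ^+ 2 %| P`_0)%Z].

Definition eisenstein (P : {poly int}) : Prop :=
  exists2 l : nat, prime l & eisenstein_at l P.

(* Main.v *)
(* Write g = f^(p^(n-1)) and h = g - x.  Modulo p, f is the operator 1 + F on
   F_p[x], where F is the q-power Frobenius, so f^(p^j) reduces to
   (1 + F)^(p^j) = 1 + F^(p^j), that is, to x + x^(q^(p^j)).  Hence
   Phi_(p^n) = (g^p - x) / h reduces to a power of x, of the same degree.

   For the constant term, write g^i = x + h B_i, so that Phi_(p^n) = B_p and
   B_(i+1) = B_i + 1 + B_i (h(x + h B_i) - h) / (h B_i).  Since h is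
   x^m modulo p with m >= 3, at x = 0 this reads
   B_(i+1)(0) = 1 + (1 + h'(0)) B_i(0) modulo p^2, with p | h'(0), so that
   B_p(0) = p + h'(0) p (p - 1) / 2 modulo p^2.  For p odd this is p; for p = 2
   one also needs 4 | h'(0), which holds because g is a compositional square. *)
Require Import Defs.
From HB Require Import structures.
From mathcomp Require Import all_boot all_order all_algebra.
From mathcomp Require Import ring zify.

Import Order.TTheory GRing.Theory Num.Theory.
Local Open Scope ring_scope.

(** * Iterates of identity plus Frobenius *)

(** The binomial theorem for the operator [1 + phi], by Pascal's rule; additivity of [phi]
    suffices. *)
Lemma iter_addid (V : zmodType) (phi : V -> V) (k : nat) (x : V) :
  {morph phi : x y / x + y} ->
  iter k (fun y => phi y + y) x = \sum_(i < k.+1) iter i phi x *+ 'C(k, i).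
Proof.
move=> phiD.
have phi0 : phi 0 = 0 by apply: (addrI (phi 0)); rewrite -phiD !addr0.
have phiMn y c : phi (y *+ c) = phi y *+ c.
  by elim: c => [|c IH]; rewrite ?mulr0n ?mulrS ?phi0 // phiD IH.
elim: k => [|k IH]; first by rewrite big_ord1.
rewrite iterS IH (big_morph phi phiD phi0) [RHS]big_ord_recl /=.
under [in RHS]eq_bigr => i _ do rewrite /bump /= add1n binS mulrnDr.
rewrite big_split /= addrA [LHS]addrC; congr (_ + _).
  rewrite big_ord_recl [in RHS]big_ord_recr /= (bin_small (ltnSn k)).
  rewrite mulr0n addr0 !bin0.
  by congr (_ + _).
by apply: eq_bigr => i _; rewrite phiMn.
Qed.

Lemma iter_Frobenius_addid (R : comNzRingType) (p q : nat) (x : R) :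
  p \in [pchar R] -> [pchar R].-nat q ->
  iter p (fun y => y ^+ q + y) x = x ^+ (q ^ p) + x.
Proof.
move=> pR qR; have p_pr := pcharf_prime pR.
have iterX i : iter i (fun y => y ^+ q) x = x ^+ (q ^ i).
  by elim: i => [|i IH]; rewrite ?expn0 ?expr1 // iterS IH -exprM -expnSr.
rewrite iter_addid; last by move=> y z; rewrite exprDn_pchar.
case: p p_pr pR => // p p_pr pR.
(* Only the two extreme terms survive: [p] divides every inner binomial coefficient. *)
rewrite big_ord_recr big_ord_recl /= binn bin0 !mulr1n big1 ?addr0.
  by rewrite iterX -exprM -expnSr addrC.
move=> i _; rewrite /bump /= add1n.
have /dvdnP [c ->] : (p.+1 %| 'C(p.+1, i.+1))%N.
  by rewrite prime_dvd_bin //= ltnS ltn_ord.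
by rewrite mulrnA mulrn_pchar.
Qed.

Lemma iter_Frobenius_addidX (R : comNzRingType) (p q j : nat) (x : R) :
  p \in [pchar R] -> [pchar R].-nat q ->
  iter (p ^ j) (fun y => y ^+ q + y) x = x ^+ (q ^ (p ^ j)) + x.
Proof.
move=> pR qR; elim: j x => [|j IH] x; first by rewrite expn0 expn1.
(* The inner iterate is again Frobenius-like, with exponent [q ^ (p ^ j)], so the prime case applies
   to it. *)
rewrite expnS iterM (eq_iter IH) iter_Frobenius_addid ?pnatX ?qR //.
by rewrite -expnM mulnC.
Qed.

(** * Compositional iterates of polynomials *)

Lemma compiterD (R : comNzRingType) (f : {poly R}) (a b : nat) :
  compiter f (a + b) = compiter f a \Po compiter f b.
Proof.
rewrite /compiter; elim: a => [|a IH]; first by rewrite comp_polyX.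
by rewrite addSn !iterS IH comp_polyA.
Qed.

Lemma compiterM (R : comNzRingType) (f : {poly R}) (a b : nat) :
  compiter f (a * b) = compiter (compiter f a) b.
Proof.
elim: b => [|b IH]; first by rewrite muln0.
by rewrite mulnS compiterD IH.
Qed.

Lemma map_compiter (R S : nzRingType) (phi : {rmorphism R -> S})
    (f : {poly R}) (j : nat) :
  map_poly phi (compiter f j) = compiter (map_poly phi f) j.
Proof.
rewrite /compiter; elim: j => [|j IH]; first by rewrite map_polyX.
by rewrite !iterS map_comp_poly IH.
Qed.

Lemma size_compiter (R : idomainType) (f : {poly R}) (j : nat) :
  (size (compiter f j)).-1 = ((size f).-1 ^ j)%N.
Proof.
rewrite /compiter; elim: j => [|j IH]; first by rewrite size_polyX.
by rewrite iterS size_comp_poly IH expnS.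
Qed.

(** Composing with ['X^q + 'X] on the left sends [g] to [g ^+ q + g], so this is the iteration above
    in the ring [{poly R}], started at ['X]. *)
Lemma compiter_Frobenius (R : comNzRingType) (p q j : nat) :
  p \in [pchar R] -> [pchar R].-nat q ->
  compiter ('X^q + 'X : {poly R}) (p ^ j) = 'X^(q ^ (p ^ j)) + 'X.
Proof.
move=> pR qR; have eqc : [pchar {poly R}] =i [pchar R] := pchar_poly R.
rewrite -(@iter_Frobenius_addidX _ p) ?eqc ?(eq_pnat _ eqc) //.
by apply: eq_iter => g; rewrite comp_polyD comp_Xn_poly comp_polyX.
Qed.

(** * The constant term of the quotient modulo [p ^+ 2] *)

Lemma comp_poly_addX (R : comNzRingType) (k y : {poly R}) :
  exists d, k \Po ('X + y) = k + y * d.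
Proof.
elim/poly_ind: k => [|k c [d IH]].
  by exists 0; rewrite comp_poly0 mulr0 addr0.
exists (d * 'X + k + y * d).
by rewrite comp_polyD comp_polyM comp_polyX comp_polyC IH; ring.
Qed.

(* [D] is the difference quotient [(h(x + y) - h(x)) / y]. *)
Lemma comp_poly_addX_at0 (R : comNzRingType) (k y : {poly R}) (c : R) :
  let h := k * 'X + c%:P in
  exists2 D, h \Po ('X + y) = h + y * D & D.[0] = k.[y.[0]].
Proof.
have [d dE] := comp_poly_addX _ k y.
(* Expand [(k \Po ('X + y)) * ('X + y)]; the summand ['X * d] vanishes at 0. *)
exists ((k \Po ('X + y)) + 'X * d).
  by rewrite comp_polyD comp_polyM comp_polyX comp_polyC dE; ring.
by rewrite !hornerE horner_comp !hornerE.
Qed.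

Lemma horner_quadratic (R : comNzRingType) (k : {poly R}) (x : R) :
  exists e, k.[x] = k`_0 + k`_1 * x + x ^+ 2 * e.
Proof.
elim/poly_ind: k => [|k c _]; first by exists 0; rewrite !hornerE !coef0; ring.
elim/poly_ind: k => [|k b _].
  by exists 0; rewrite !hornerE !coefE /=; ring.
by exists k.[x]; rewrite !hornerE !coefE /=; ring.
Qed.

(** Here [p * t] is [h'(0)] and [p * c] is [h(0)]. The recurrence for [B.[0]] multiplies by
    [1 + p * t] and adds 1 modulo [p ^+ 2]; Pascal's rule then produces ['C(i, 2)]. *)
Lemma compiter_quotient (p : nat) (t s : int) (k : {poly int}) (c : int)
    (i : nat) :
  let h := k * 'X + (p%:Z * c)%:P in
  k`_0 = p%:Z * t -> k`_1 = p%:Z * s ->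
  exists2 B, compiter ('X + h) i = 'X + h * B &
    exists e, B.[0] = i%:R + p%:Z * t * 'C(i, 2)%:R + p%:Z ^+ 2 * e.
Proof.
move=> h k0 k1; elim: i => [|i [B BE [e eE]]].
  exists 0; first by rewrite mulr0 addr0.
  by exists 0; rewrite horner0 bin0n /= !mulr0 !addr0.
have [D DE D0] := comp_poly_addX_at0 _ k (h * B) (p%:Z * c).
exists (B + 1 + B * D).
  by rewrite /compiter iterS -/(compiter _ _) BE comp_polyD comp_polyX DE -/h;
     ring.
have [w wE] := horner_quadratic _ k (h * B).[0].
(* This value and [k]_1[are both multiples of]p[, so beyond]k[_0] the expansion of [k] at it
   vanishes modulo [p ^+ 2]. *)
have hB0 : (h * B).[0] = p%:Z * (c * B.[0]) by rewrite hornerM {1}/h !hornerE.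
rewrite !hornerE D0 wE k0 k1 hB0 binS bin1 natrD.
set b := B.[0] in eE *; set C := 'C(i, 2)%:R in eE *.
exists (e + t * (t * C + p%:Z * e)
        + b * (s * c * b + c ^+ 2 * b ^+ 2 * w)).
(* Isolate the occurrence of [b] that is not multiplied by [p ^+ 2]. *)
transitivity (b * (1 + p%:Z * t) + 1
              + p%:Z ^+ 2 * (b * (s * c * b + c ^+ 2 * b ^+ 2 * w))).
  by ring.
by rewrite {1}eE -natr1; ring.
Qed.

Lemma prime_sqr_ndvd (p : nat) (t e : int) :
  prime p -> (p = 2%N -> (2 %| t)%Z) ->
  ~~ (p%:Z ^+ 2 %| p%:R + p%:Z * t * 'C(p, 2)%:R + p%:Z ^+ 2 * e)%Z.
Proof.
move=> p_pr t2; have p_neq0 : p%:Z != 0 by case: p p_pr {t2}.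
rewrite rpredDr; last exact: dvdz_mulr.
rewrite rpredDr.
  rewrite expr2 natz -[X in (_ %| X)%Z]mulr1 dvdz_mul2l //.
  by rewrite dvdz1 absz_nat; case: p p_pr {t2 p_neq0} => [|[]].
(* The second factor [p] comes from [t] when [p = 2], since ['C(2, 2) = 1], and from ['C(p, 2)] when
   [p] is odd. *)
rewrite expr2 -mulrA dvdz_mul //; have [p2 | p_odd] := even_prime p_pr.
  by rewrite p2 binn mulr1 t2.
by rewrite bin2odd // natrM natz dvdz_mull // dvdz_mulr.
Qed.

(** By the chain rule the coefficient is [e'(e(0)) * e'(0)]. As [e(0)] is even and [e'] has an even
    linear coefficient, this is [e'(0) ^+ 2] modulo 4, an odd square. *)
Lemma coef1_comp_square (e : {poly int}) :
  (2 %| e`_0)%Z -> ~~ (2 %| e`_1)%Z -> (4 %| (e \Po e)`_1 - 1)%Z.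
Proof.
move=> /dvdzP [s sE] e1.
have -> : (e \Po e)`_1 = e^`().[e`_0] * e`_1.
  have coef1E (P : {poly int}) : P`_1 = P^`().[0].
    by rewrite horner_coef0 coef_deriv mulr1n.
  rewrite coef1E deriv_comp hornerM horner_comp -coef1E.
  by rewrite [e.[0]]horner_coef0.
have [w ->] := horner_quadratic _ e^`() e`_0.
rewrite !coef_deriv mulr1n sE.
have [v vE] : exists v, e`_1 = 1 + 2 * v.
  by exists ((e`_1 - 1) %/ 2)%Z; lia.
apply/dvdzP; exists (v + v ^+ 2 + (e`_2 * s + s ^+ 2 * w) * e`_1).
by rewrite vE; ring.
Qed.

(** * The dynatomic product at a prime power *)

Lemma mobius_prime (p : nat) : prime p -> mobius p = -1.
Proof. by move=> p_pr; rewrite /mobius primes_prime //= logn_prime // eqxx. Qed.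

Lemma mobius_primeX (p k : nat) : prime p -> mobius (p ^ k.+2) = 0.
Proof.
move=> p_pr; rewrite /mobius primesX // primes_prime //= lognX logn_prime //.
by rewrite eqxx muln1.
Qed.

Lemma perm_divisors_primeX (p n : nat) : prime p ->
  perm_eq (divisors (p ^ n)) [seq (p ^ i)%N | i <- index_iota 0 n.+1].
Proof.
move=> p_pr; have p_gt1 := prime_gt1 p_pr.
apply: uniq_perm; first exact: divisors_uniq.
  by rewrite map_inj_uniq ?iota_uniq //; apply: expnI.
move=> d; rewrite -dvdn_divisors ?expn_gt0 ?prime_gt0 //.
apply/(dvdn_pfactor _ _ p_pr)/mapP => -[i].
  by move=> le_in ->; exists i; rewrite // mem_index_iota ltnS.
by rewrite mem_index_iota ltnS => le_in ->; exists i.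
Qed.

Lemma dynatomic_primeX (f : {poly int}) (p n : nat) : prime p ->
  dynatomic f (p ^ n.+1) =
  tofrac (compiter f (p ^ n.+1) - 'X) / tofrac (compiter f (p ^ n) - 'X).
Proof.
move=> p_pr; have p_gt0 := prime_gt0 p_pr.
rewrite /dynatomic (perm_big _ (perm_divisors_primeX _ _ p_pr)) big_map /=.
rewrite big_nat_recr // big_nat_recr //= big_nat big1 => [|i /andP [_ lt_in]].
  rewrite mul1r divnn expn_gt0 p_gt0 expnS mulnK ?expn_gt0 ?p_gt0 //.
  by rewrite mobius_prime // mulrC.
(* For [i < n] the cofactor is divisible by [p ^ 2], so its Möbius exponent is 0. *)
rewrite -expnB // ?ltnS; last by rewrite ltnW // ltnW.
have -> : (n.+1 - i = (n.-1 - i).+2)%N by lia.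
by rewrite mobius_primeX.
Qed.

(** * Reduction modulo [p] *)

Section Reduction.

Variables (p q r : nat) (f : {poly int}).
Hypotheses (p_pr : prime p) (r_gt0 : (0 < r)%N) (qE : q = (p ^ r)%N).
Hypothesis size_f : size f = q.+1.
Hypothesis f_red : map_poly (intr : int -> 'F_p) f = 'X^q + 'X.

Let red := map_poly (intr : int -> 'F_p).

Lemma q_gt1 : (1 < q)%N.
Proof. by rewrite qE (leq_ltn_trans r_gt0) // ltn_expl // prime_gt1. Qed.

Lemma expq_gt1 j : (0 < j)%N -> (1 < q ^ j)%N.
Proof. by move=> j_gt0; apply: leq_ltn_trans j_gt0 (ltn_expl _ q_gt1). Qed.

Lemma red_coef_dvd (P : {poly int}) i : (p%:Z %| P`_i)%Z = ((red P)`_i == 0).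
Proof. by rewrite (dvdz_pcharf (pchar_Fp p_pr)) coef_map. Qed.

Lemma red_compiter j : red (compiter f (p ^ j)) = 'X^(q ^ (p ^ j)) + 'X.
Proof.
have pF := pchar_Fp p_pr.
rewrite /red map_compiter f_red compiter_Frobenius // qE pnatX.
by rewrite (eq_pnat _ (pcharf_eq pF)) pnat_id.
Qed.

Lemma size_compiter_subX j : (0 < j)%N ->
  size (compiter f j - 'X) = (q ^ j).+1.
Proof.
move=> j_gt0; have qj_gt1 := expq_gt1 _ j_gt0.
have sizeE : size (compiter f j) = (q ^ j).+1.
  move: (size_compiter _ f j) qj_gt1; rewrite size_f /= => <-.
  by case: (size _).
by rewrite size_polyDl sizeE // size_polyN size_polyX.
Qed.

Lemma eisenstein_compiter_quotient n (P : {poly int}) :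
  compiter f (p ^ n.+2) - 'X = (compiter f (p ^ n.+1) - 'X) * P ->
  ~~ (p%:Z ^+ 2 %| P`_0)%Z -> eisenstein_at p P.
Proof.
move=> PE P0.
have lt_mM : (q ^ (p ^ n.+1) < q ^ (p ^ n.+2))%N.
  by rewrite ltn_exp2l ?q_gt1 // ltn_exp2l ?prime_gt1.
set m := (q ^ _)%N in lt_mM; set M := (q ^ _)%N in lt_mM.
(* The two differences reduce to ['X^M] and ['X^m]; cancel ['X^m] in the domain of polynomials over
   ['F_p]. *)
have redP : red P = 'X^(M - m).
  have: red (compiter f (p ^ n.+2) - 'X) =
        red (compiter f (p ^ n.+1) - 'X) * red P.
    by rewrite PE /red rmorphM.
  rewrite /red !rmorphB /= -!/(red _) !red_compiter /red map_polyX !addrK.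
  rewrite -/m -/M -{1}(subnKC (ltnW lt_mM)) exprD.
  by move/(mulfI (expf_neq0 _ (negbT (polyX_eq0 _)))).
have P_neq0 : P != 0.
  apply: contra_eqN redP => /eqP ->.
  by rewrite /red rmorph0 eq_sym monic_neq0 ?monicXn.
(* The degree over the integers is also [M - m], so the leading coefficient is the one that reduces
   to 1. *)
have sizeP : size P = (M - m).+1.
  have pX_gt0 j : (0 < p ^ j)%N by rewrite expn_gt0 prime_gt0.
  have sizeH := size_compiter_subX _ (pX_gt0 _).
  have := sizeH n.+2; rewrite PE size_mul // -?size_poly_eq0 sizeH //.
  by rewrite addSn /= => sizeM; rewrite -subSn ?(ltnW lt_mM) // -sizeM addKn.
split=> //.
- by rewrite sizeP ltnS subn_gt0.
- by rewrite lead_coefE sizeP red_coef_dvd redP coefXn eqxx oner_eq0.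
- by move=> i; rewrite sizeP /= red_coef_dvd redP coefXn => /ltn_eqF ->.
Qed.

End Reduction.

Theorem theorem1p1 (p q r : nat) (f : {poly int}) (n : nat)
  (hp : prime p) (hr : (0 < r)%N) (hq : q = (p ^ r)%N)
  (hdeg : size f = q.+1)
  (hred : map_poly (fun a : int => a%:~R : 'F_p) f = 'X^q + 'X)
  (hn : (2 <= n)%N) :
  exists2 P : {poly int},
    tofrac P = dynatomic f (p ^ n) & eisenstein P.
Proof.
case: n hn => [|[|n]] // _.
pose g := compiter f (p ^ n.+1); pose h := g - 'X.
(* [h] reduces to a power of ['X] with exponent at least [q ^ 2], hence at least 4. *)
have dvd_h i : (i < 3)%N -> (p%:Z %| h`_i)%Z.
  move=> lt_i3; rewrite (red_coef_dvd _ hp) rmorphB /=.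
  rewrite (red_compiter _ _ _ _ hp hq hred) map_polyX addrK coefXn ltn_eqF //.
  apply: leq_trans lt_i3 _.
  have p2 := prime_gt1 hp; have q2 := q_gt1 _ _ _ hp hr hq.
  have pn : (p <= p ^ n.+1)%N by rewrite expnS leq_pmulr // expn_gt0 ltnW.
  apply: (@leq_trans (q ^ 2)); last by rewrite leq_exp2l // (leq_trans p2).
  by apply: (@leq_trans (2 ^ 2)); rewrite ?leq_sqr.
have /dvdzP [c cE] := dvd_h 0 isT; have /dvdzP [t tE] := dvd_h 1 isT.
have /dvdzP [s sE] := dvd_h 2%N isT.
pose k := drop_poly 1 h.
have hE : h = k * 'X + (p%:Z * c)%:P.
  apply/polyP => -[|i]; rewrite [RHS]coefD coefMX coefC /=.
    by rewrite cE add0r mulrC.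
  by rewrite coef_drop_poly addn1 addr0.
have k0 : k`_0 = p%:Z * t by rewrite coef_drop_poly tE mulrC.
have k1 : k`_1 = p%:Z * s by rewrite coef_drop_poly sE mulrC.
have [P PE [e eE]] := compiter_quotient p _ _ k c p k0 k1.
(* The iterate on the left is the [p]-fold iterate of [g], so the quotient is [B] at index [p]. *)
have hP : compiter f (p ^ n.+2) - 'X = h * P.
  have gE : g = 'X + h by rewrite /h addrC subrK.
  by rewrite expnSr compiterM -/g gE hE PE [X in X - _]addrC addrK.
exists P.
  have h_neq0 : h != 0.
    by rewrite -size_poly_eq0 (size_compiter_subX _ _ _ _ hp hr hq hdeg) //
               expn_gt0 prime_gt0.
  by rewrite dynatomic_primeX // hP rmorphM /= mulrAC divff ?mul1r ?tofrac_eq0.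
exists p => //.
apply: (eisenstein_compiter_quotient _ _ _ _ hp hr hq hdeg hred n) => //.
rewrite -horner_coef0 eE prime_sqr_ndvd // => p2.
(* Only [p = 2] remains. Modulo 2, [u] is ['X] plus a power of ['X] of exponent at least 2, so
   [u(0)] is even and [u'(0)] is odd. *)
pose u := compiter f (p ^ n).
have gE : g = u \Po u.
  by rewrite /g expnSr compiterM -/u p2 /compiter /= comp_polyXr.
have redu := red_compiter _ _ _ _ hp hq hred n; rewrite -/u in redu.
have Q_gt1 : (1 < q ^ (p ^ n))%N.
  by rewrite (expq_gt1 _ _ _ hp hr hq) // expn_gt0 prime_gt0.
have: (4 %| h`_1)%Z.
  rewrite coefB coefX gE coef1_comp_square //.
  - by rewrite -[2]/(2%N%:Z) -p2 (red_coef_dvd _ hp) redu !coefE !ltn_eqF //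
               ltnW.
  - by rewrite -[2]/(2%N%:Z) -p2 (red_coef_dvd _ hp) redu !coefE ltn_eqF.
by rewrite tE p2; lia.
Qed.
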